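(* Let $(X,\|\cdot\|_X)$ be a pervasive Archimedean pre-Riesz space equipped with an order continuous regular seminorm. Let $(X^\delta,i)$ be the Dedekind completion of $X$, equipped with the seminorm \[\|y\|_{X^\delta}:=\inf\{\|x\|_X\colon\, x\in X \text{ such that } -i(x)\le y\le i(x)\},\qquad y\in X^\delta.\] Let $Y$ be a Banach lattice with an order continuous norm. If $T\in L(X,Y)$ is a bounded operator, then there exists a unique bounded linear extension $\widehat T\in L(X^\delta,Y)$ of $T$ (i.e. $\widehat T\circ i=T$). If $T$ is compact, then $\widehat T$ is compact as well.
   Context: All spaces are real. A partially ordered vector space $X$ is Archimedean if $x,y\in X$ and $nx\le y$ for all $n\in\mathbb{N}$ imply $x\le 0$. For a finite set $M\subset X$, $M^{\mathrm u}$ denotes its set of upper bounds. $X$ is a pre-Riesz space if for all $x,y,z\in X$ the inclusion $\{x+y,x+z\}^{\mathrm u}\subseteq\{y,z\}^{\mathrm u}$ implies $x\ge 0$. A linear map $i$ is bipositive if $x\ge 0\iff i(x)\ge 0$. A subspace $D$ of $Z$ is order dense in $Z$ if $z=\inf\{d\in D\colon d\ge z\}$ for every $z\in Z$. The Riesz completion $(X^\rho,i_\rho)$ of a pre-Riesz space $X$ is the (essentially unique) vector lattice $X^\rho$ with a bipositive linear map $i_\rho\colon X\to X^\rho$ such that $i_\rho(X)$ is order dense in $X^\rho$ and generates $X^\rho$ as a vector lattice. $X$ is pervasive if for every $y\in X^\rho$ with $y>0$ there is $x\in X$ with $0<i_\rho(x)\le y$. The Dedekind completion $(X^\delta,i)$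 of an Archimedean pre-Riesz space $X$ is the (essentially unique) Dedekind complete vector lattice $X^\delta$ with a bipositive linear map $i\colon X\to X^\delta$ such that $i(X)$ is order dense in $X^\delta$. A net $(x_\alpha)$ order converges to $x$ if there is a net $(y_\beta)$ with $y_\beta\downarrow 0$ such that for every $\beta$ there is $\alpha_0$ with $\pm(x_\alpha-x)\le y_\beta$ for all $\alpha\ge\alpha_0$. A (semi)norm $p$ is order continuous if $p(x_\alpha-x)\to 0$ whenever $(x_\alpha)$ order converges to $x$. A seminorm $p$ on $X$ is regular if $p(x)=\inf\{p(y)\colon y\in X,\ -y\le x\le y\}$ for all $x\in X$. $L(\cdot,\cdot)$ denotes the bounded linear operators between (semi)normed spaces. An operator is compact if it maps every norm bounded sequence to a sequence with a norm convergent subsequence. *)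

(* Defs.v *)
From HB Require Import structures.
From mathcomp Require Import all_boot all_order all_algebra.
From mathcomp Require Import all_classical all_reals all_analysis.

Set Implicit Arguments.
Unset Strict Implicit.
Unset Printing Implicit Defensive.

Import Order.TTheory GRing.Theory Num.Theory.
Import numFieldNormedType.Exports.

Local Open Scope classical_set_scope.
Local Open Scope ring_scope.

HB.mixin Record POrderedZmodule_isOrderedVector (R : realType) (V : Type)
    of Num.POrderedZmodule V & GRing.Lmodule R V := {
  lev_wD2r : forall z x y : V, x <= y -> x + z <= y + z ;
  scalev_ge0 : forall (a : R) (x : V), 0 <= a -> 0 <= x -> 0 <= a *: x
}.

#[short(type="orderedVectorType")]
HB.structure Definition OrderedVector (R : realType) :=
  { V of POrderedZmodule_isOrderedVector R V & Num.POrderedZmodule V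
       & GRing.Lmodule R V }.

(* [Order.Lattice] cannot be joined with a module structure here: HB rejects the
   join because [Num.RealDomain] already inherits from both hierarchies. Binary
   suprema are therefore supplied by a separate mixin; infima are obtained as
   inf {x, y} = - sup {- x, - y}. *)
HB.mixin Record OrderedVector_isVectorLattice (R : realType) (V : Type)
    of OrderedVector R V := {
  vjoin : V -> V -> V ;
  vjoinP : forall x y : V, supremums [set x; y] (vjoin x y)
}.

#[short(type="vectorLatticeType")]
HB.structure Definition VectorLattice (R : realType) :=
  { V of OrderedVector_isVectorLattice R V & OrderedVector R V }.

Definition vmeet (R : realType) (V : vectorLatticeType R) (x y : V) : V :=
  - vjoin (- x) (- y).

Definition absv (R : realType) (V : vectorLatticeType R) (x : V) : V :=
  vjoin x (- x).

Definition archimedean (R : realType) (V : orderedVectorType R) : Prop :=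
  forall x y : V, (forall n : nat, x *+ n <= y) -> x <= 0.

Definition pre_riesz (R : realType) (V : orderedVectorType R) : Prop :=
  forall x y z : V,
    ubound [set x + y; x + z] `<=` ubound [set y; z] -> 0 <= x.

Definition dedekind_complete (R : realType) (V : orderedVectorType R) : Prop :=
  forall A : set V, A !=set0 -> has_ubound A -> exists s, supremums A s.

Definition bipositive (R : realType) (V W : orderedVectorType R)
    (i : {linear V -> W}) : Prop :=
  forall x : V, 0 <= x <-> 0 <= i x.

Definition order_dense (R : realType) (V : orderedVectorType R) (D : set V)
    : Prop :=
  forall z : V, infimums [set d | D d /\ z <= d] z.

Record vector_sublattice (R : realType) (V : vectorLatticeType R) (S : set V)
    : Prop := VectorSublattice {
  sublattice0 : S 0 ;
  sublatticeD : forall x y : V, S x -> S y -> S (x + y) ;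
  sublatticeZ : forall (a : R) (x : V), S x -> S (a *: x) ;
  sublattice_join : forall x y : V, S x -> S y -> S (vjoin x y) ;
  sublattice_meet : forall x y : V, S x -> S y -> S (vmeet x y)
}.

Definition generates_lattice (R : realType) (V : vectorLatticeType R)
    (D : set V) : Prop :=
  forall S : set V, vector_sublattice S -> D `<=` S -> S = setT.

Record riesz_completion (R : realType) (X : orderedVectorType R)
    (Z : vectorLatticeType R) (i : {linear X -> Z}) : Prop := RieszCompletion {
  riesz_bipositive : bipositive i ;
  riesz_order_dense : order_dense (range i) ;
  riesz_generates : generates_lattice (range i)
}.

Record dedekind_completion (R : realType) (X : orderedVectorType R)
    (Z : vectorLatticeType R) (i : {linear X -> Z}) : Prop :=
  DedekindCompletion {
  dedekind_target_complete : dedekind_complete Z ;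
  dedekind_bipositive : bipositive i ;
  dedekind_order_dense : order_dense (range i)
}.

(* The Riesz completion of a pre-Riesz space exists and is unique up to
   isomorphism, so it does not matter which one is used. *)
Definition pervasive (R : realType) (X : orderedVectorType R) : Prop :=
  exists (Z : vectorLatticeType R) (i : {linear X -> Z}),
    riesz_completion i /\
    (forall y : Z, 0 < y -> exists x : X, 0 < i x <= y).

Record directed (A : Type) (leA : A -> A -> Prop) : Prop := Directed {
  directed_inhabited : inhabited A ;
  directed_refl : forall a, leA a a ;
  directed_trans : forall a b c, leA a b -> leA b c -> leA a c ;
  directed_ub : forall a b, exists c, leA a c /\ leA b c
}.

Definition net_decreases_to0 (R : realType) (V : orderedVectorType R)
    (B : Type) (leB : B -> B -> Prop) (y : B -> V) : Prop :=
  (forall b b', leB b b' -> y b' <= y b) /\ infimums (range y) 0.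

Definition order_cvg (R : realType) (V : orderedVectorType R)
    (A : Type) (leA : A -> A -> Prop) (x : A -> V) (l : V) : Prop :=
  exists (B : Type) (leB : B -> B -> Prop) (y : B -> V),
    [/\ directed leB,
        net_decreases_to0 leB y
      & forall b, exists a0, forall a, leA a0 a ->
          x a - l <= y b /\ - (x a - l) <= y b].

Record seminorm (R : realType) (V : lmodType R) (p : V -> R) : Prop :=
  Seminorm {
  seminorm_ge0 : forall x : V, 0 <= p x ;
  seminormZ : forall (a : R) (x : V), p (a *: x) = `|a| * p x ;
  seminormD : forall x y : V, p (x + y) <= p x + p y
}.

Definition order_continuous (R : realType) (V : orderedVectorType R)
    (p : V -> R) : Prop :=
  forall (A : Type) (leA : A -> A -> Prop) (x : A -> V) (l : V),
    directed leA -> order_cvg leA x l ->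
    forall e : R, 0 < e -> exists a0, forall a, leA a0 a -> p (x a - l) < e.

(* [infimums] rather than [inf], whose value on the empty set is 0. *)
Definition regular (R : realType) (V : orderedVectorType R) (p : V -> R)
    : Prop :=
  forall x : V, infimums (p @` [set y | - y <= x <= y]) (p x).

(* The set is nonempty and bounded below when [i] is order dense and bipositive
   and [p] is a seminorm, so [inf] is the true infimum. *)
Definition ext_seminorm (R : realType) (X Z : orderedVectorType R)
    (i : {linear X -> Z}) (p : X -> R) (y : Z) : R :=
  inf (p @` [set x | - i x <= y <= i x]).

(* The norm is a function [q : V -> R] because HB cannot join [NormedModule]
   with a partial order: [Num.NumDomain] already inherits from both. *)
Record banach_lattice (R : realType) (V : vectorLatticeType R) (q : V -> R)
    : Prop := BanachLattice {
  banach_seminorm : seminorm q ;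
  banach_definite : forall x : V, q x = 0 -> x = 0 ;
  banach_absv : forall x y : V, absv x <= absv y -> q x <= q y ;
  banach_complete : forall u : nat -> V,
    (forall e : R, 0 < e -> exists N : nat, forall m n : nat,
       (N <= m)%N -> (N <= n)%N -> q (u m - u n) < e) ->
    exists l : V, q (u n - l) @[n --> \oo] --> (0 : R)
}.

Definition bounded_operator (R : realType) (V W : lmodType R)
    (p : V -> R) (q : W -> R) (T : {linear V -> W}) : Prop :=
  exists C : R, forall x : V, q (T x) <= C * p x.

Definition compact_operator (R : realType) (V W : lmodType R)
    (p : V -> R) (q : W -> R) (T : {linear V -> W}) : Prop :=
  forall u : nat -> V, (exists M : R, forall n, p (u n) <= M) ->
    exists phi : nat -> nat, {homo phi : m n / (m < n)%N} /\
      exists l : W, q (T (u (phi n)) - l) @[n --> \oo] --> (0 : R).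

(* Main.v *)
Require Import Defs.
From HB Require Import structures.
From mathcomp Require Import all_boot all_order all_algebra.
From mathcomp Require Import all_classical all_reals all_analysis.

(** Everything reduces to one density statement, [range_dense]: every [y] in
the Dedekind completion [Z] is approximated by some [i x] with an error
[y - i x] that lies between [- i z] and [i z] for a [z] of arbitrarily small
seminorm. Once this is known, [T] extends by completeness of the target, as any
bounded operator on a dense subspace does.

For the density, order denseness writes [y] as the supremum of all the
[i a <= y] and as the infimum of all the [i b >= y], so the differences [b - a]
have infimum [0] in [X]. Order continuity, however, speaks of nets, and since
[X] is not a lattice these [a] need not form a directed set. Pervasiveness
repairs this. By Zorn's lemma there is a maximal upward directed set [M] of
elements [a] with [i a <= y]. Let [s] be the supremum of its image. If [s < y],
pervasiveness provides [v > 0] with [i v <= y - s]; adding the translate [M + v]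
to [M] keeps it directed and below [y], so maximality gives [m + v] in [M] for
all [m] in [M], whence [s + i v <= s], which is absurd. Thus [y] is the supremum
of an upward directed set ([upward_directed_sup]). The same holds for [- y],
and the two directed sets together give a net in [X] that decreases to [0] and
dominates the approximation errors, so its seminorm gets small.

The extension is built as the closure of the graph of [T]: a linear relation
that is bounded, hence single-valued, and total because the target is complete.
Any bounded extension of [T] lies in that closure, so it is unique. For
compactness, approximate a bounded sequence [u n] by [i (x n)] with error at
most [1 / (n + 1)]; the [x n] are bounded, and [That (u n)] and [T (x n)] have
the same limits along subsequences. *)

Set Implicit Arguments.
Unset Strict Implicit.
Unset Printing Implicit Defensive.

Import Order.TTheory GRing.Theory Num.Theory.
Import numFieldNormedType.Exports.

Local Open Scope classical_set_scope.
Local Open Scope ring_scope.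

(** * Ordered vector spaces *)

Lemma subv_ge0 (R : realType) (V : orderedVectorType R) (x y : V) :
  (0 <= y - x) = (x <= y).
Proof.
apply/idP/idP => [/(@lev_wD2r _ _ x)|/(@lev_wD2r _ _ (- x))].
  by rewrite add0r subrK.
by rewrite subrr.
Qed.

Lemma lev_add2r (R : realType) (V : orderedVectorType R) (z x y : V) :
  (x + z <= y + z) = (x <= y).
Proof. by rewrite -[LHS]subv_ge0 opprD addrACA subrr addr0 subv_ge0. Qed.

Lemma lev_D (R : realType) (V : orderedVectorType R) (x y z t : V) :
  x <= y -> z <= t -> x + z <= y + t.
Proof.
move=> xy zt; apply: (@le_trans _ _ (y + z)); first by rewrite lev_add2r.
by rewrite ![y + _]addrC lev_add2r.
Qed.

Lemma lev_N (R : realType) (V : orderedVectorType R) (x y : V) :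
  (- x <= - y) = (y <= x).
Proof. by rewrite -[LHS]subv_ge0 opprK addrC subv_ge0. Qed.

Lemma lev_subr (R : realType) (V : orderedVectorType R) (x y z : V) :
  (x <= z - y) = (x + y <= z).
Proof. by rewrite -[LHS](lev_add2r y) subrK. Qed.

Lemma bipositive_le (R : realType) (V W : orderedVectorType R)
    (i : {linear V -> W}) (i_bipos : bipositive i) (x y : V) :
  (i x <= i y) = (x <= y).
Proof.
rewrite -[LHS]subv_ge0 -linearB -[RHS]subv_ge0.
by apply/idP/idP => /i_bipos.
Qed.

Lemma bipositive_gt0 (R : realType) (V W : orderedVectorType R)
    (i : {linear V -> W}) (i_bipos : bipositive i) (x : V) :
  0 < i x -> 0 < x.
Proof.
rewrite !lt_def => /andP[ix0 /i_bipos ->]; rewrite andbT.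
by apply: contraNneq ix0 => ->; rewrite linear0.
Qed.

(** * Pervasiveness in the Dedekind completion *)

(** Pervasiveness refers to some Riesz completion [Z] of [X]. To carry it over
to other completions, it is rephrased inside [X]: the conclusion says that [v]
lies below the positive part of [x], which is tested on upper bounds in [X]. *)
Lemma pervasive_minorant (R : realType) (X : orderedVectorType R)
    (X_pervasive : pervasive X) (x : X) :
  ~~ (x <= 0) ->
  exists2 v : X, 0 < v & forall w, x <= w -> 0 <= w -> v <= w.
Proof.
move: X_pervasive => [Z [j [[j_bipos _ _] j_perv]]] xN0.
have [xj_ub xj_least] := vjoinP (j x) 0.
have jx_le : j x <= vjoin (j x) 0 by apply: xj_ub; left.
have join_gt0 : 0 < vjoin (j x) 0.
  rewrite lt_def xj_ub ?andbT; last by right.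
  apply: contraNneq xN0 => join0.
  by rewrite -(bipositive_le j_bipos) linear0 -join0.
have [v /andP[jv_gt0 jv_le]] := j_perv _ join_gt0.
exists v; first exact: bipositive_gt0 jv_gt0.
move=> w xw w0; rewrite -(bipositive_le j_bipos).
apply: (le_trans jv_le); apply: xj_least => _ [->|->].
  by rewrite bipositive_le.
by apply/j_bipos.
Qed.

(** A point is the infimum of the range elements above it, so lower bounds need
only be checked on these. *)
Lemma order_dense_ge (R : realType) (X Z : orderedVectorType R)
    (i : {linear X -> Z}) (i_dense : order_dense (range i)) (z y : Z) :
  (forall x, y <= i x -> z <= i x) -> z <= y.
Proof.
by move=> zle; apply: (i_dense y).2 => _ [[x _ <-] yx]; apply: zle.
Qed.

(** As [y] is not below [0], some [x] with [i x <= y] is not below [0] either;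
the minorant [v] of the positive part of [x] is then below every [i w >= y],
because such a [w] is above both [x] and [0]. *)
Lemma pervasive_completion (R : realType) (X Z : orderedVectorType R)
    (i : {linear X -> Z}) (X_pervasive : pervasive X)
    (i_bipos : bipositive i) (i_dense : order_dense (range i)) (y : Z) :
  0 < y -> exists2 v : X, 0 < v & i v <= y.
Proof.
move=> y_gt0.
have [x ixy xN0] : exists2 x : X, i x <= y & ~~ (x <= 0).
  apply: contrapT => all_neg.
  suff : 0 <= - y by rewrite -oppr0 lev_N => /le_gtF; rewrite y_gt0.
  apply: (order_dense_ge i_dense) => x yx; rewrite -lev_N -linearN oppr0.
  rewrite -(linear0 i) bipositive_le//; apply: contrapT => /negP xN0.
  by apply: all_neg; exists (- x); rewrite // linearN -lev_N opprK.
have [v v_gt0 v_min] := pervasive_minorant X_pervasive xN0.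
exists v => //; apply: (order_dense_ge i_dense) => w yw.
rewrite bipositive_le//; apply: v_min.
  by rewrite -(bipositive_le i_bipos); apply: le_trans yw.
by apply/i_bipos; apply: le_trans yw; apply: ltW.
Qed.

(** Otherwise [y], being the infimum of the empty set, would be a greatest
element; then [y + y <= y], so [i 0] is above [y]. *)
Lemma order_dense_above (R : realType) (X Z : orderedVectorType R)
    (i : {linear X -> Z}) (i_dense : order_dense (range i)) (y : Z) :
  exists x, y <= i x.
Proof.
apply: contrapT => no_ub; case: (no_ub); exists 0.
rewrite linear0 -(lev_add2r y) add0r.
by apply: (order_dense_ge i_dense) => x yx; case: no_ub; exists x.
Qed.

(** The empty set is allowed, so that unions of chains, the empty chain
included, stay within the scope of Zorn's lemma. *)
Definition upward_directed (R : realType) (X : orderedVectorType R)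
    (M : set X) : Prop :=
  forall a b, M a -> M b -> exists c, [/\ M c, a <= c & b <= c].

(** A maximal upward directed set below [y] has supremum [y]: by pervasiveness,
a gap between that supremum and [y] would leave room for a translate. *)
Lemma upward_directed_sup (R : realType) (X : orderedVectorType R)
    (Z : vectorLatticeType R)
    (i : {linear X -> Z}) (X_pervasive : pervasive X)
    (i_compl : dedekind_completion i) (y : Z) :
  exists M : set X, [/\ M !=set0, upward_directed M & supremums (i @` M) y].
Proof.
have [Z_compl i_bipos i_dense] := i_compl.
pose P := [set M : set X | upward_directed M /\ forall a, M a -> i a <= y].
have [F FP F_chain|M [[M_up M_le] M_max]] := @Zorn_bigcup X P.
  split=> [a b [A FA Aa] [B FB Bb]|a [A /FP[_ A_le]]]; last exact: A_le.
  wlog AB : A B FA FB a b Aa Bb / A `<=` B => [hwlog|].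
    have [AB|BA] := F_chain _ _ FA FB; first exact: (hwlog A B).
    by have [c [Fc bc ac]] := hwlog B A FB FA b a Bb Aa BA; exists c.
  have [c [Bc ac bc]] := (FP _ FB).1 _ _ (AB _ Aa) Bb.
  by exists c; split=> //; exists B.
have M0 : M !=set0.
  apply/set0P/eqP => M0.
  have [x xy] := order_dense_above i_dense (- y).
  apply: (M_max [set - x]).
    by rewrite M0; split=> [|/(_ (- x) erefl)].
  split=> [_ _ -> ->|_ ->]; first by exists (- x).
  by rewrite linearN -lev_N opprK.
exists M; split=> //.
have [||s [s_ub s_least]] := Z_compl (i @` M).
  by have [m Mm] := M0; exists (i m), m.
  by exists y => _ [m Mm <-]; exact: M_le.
have sy : s <= y by apply: s_least => _ [m Mm <-]; exact: M_le.
have [<-//|s_neq_y] := eqVneq s y.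
have ys_gt0 : 0 < y - s by rewrite lt_def subv_ge0 sy subr_eq0 eq_sym s_neq_y.
have [v v_gt0 iv_le] :=
  pervasive_completion X_pervasive i_bipos i_dense ys_gt0.
(* Maximality of [M] against the directed set [M] together with [M + v]. *)
have vM m : M m -> M (m + v).
  move=> Mm; apply: contrapT => MNmv.
  apply: (M_max (M `|` [set a + v | a in M])).
    split=> [a Ma|]; first by left.
    by move=> /(_ (m + v)) /(_ (or_intror (ex_intro2 _ _ m Mm erefl))).
  have le_v (a : X) : a <= a + v by rewrite -{1}[a]addr0 lev_D// ltW.
  split=> [a b Ha Hb|_ [/M_le//|[a Ma <-]]]; last first.
    rewrite linearD [i a + _]addrC -[y](subrK s) lev_D//.
    by apply: s_ub; exists a.
  have up c : (M `|` [set a + v | a in M]) c -> exists2 d, M d & c <= d + v.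
    by case=> [Mc|[d Md <-]]; [exists c|exists d].
  have [a' Ma' aa'] := up _ Ha; have [b' Mb' bb'] := up _ Hb.
  have [c [Mc ac bc]] := M_up _ _ Ma' Mb'; exists (c + v).
  split; first by right; exists c.
    by apply: le_trans aa' _; rewrite lev_add2r.
  by apply: le_trans bb' _; rewrite lev_add2r.
suff : v <= 0 by rewrite lt_geF.
rewrite -(bipositive_le i_bipos) linear0 -(lev_add2r s) add0r addrC.
rewrite -lev_subr; apply: s_least => _ [m Mm <-].
by rewrite lev_subr -linearD; apply: s_ub; exists (m + v) => //; exact: vM.
Qed.

(** * Density of the space in its Dedekind completion *)

Definition dominates (R : realType) (X Z : orderedVectorType R)
  (i : {linear X -> Z}) (z : X) (y : Z) : Prop := - i z <= y <= i z.

Lemma directed_decreases_to0_lt (R : realType) (X : orderedVectorType R)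
    (p : X -> R) (p_oc : order_continuous p)
    (A : Type) (leA : A -> A -> Prop) (y : A -> X) (e : R) :
  directed leA -> net_decreases_to0 leA y -> 0 < e -> exists a, p (y a) < e.
Proof.
move=> A_dir [y_dec y_inf] e_gt0.
have y_cvg : order_cvg leA y 0.
  exists A, leA, y; split=> // b; exists b => a ba; rewrite subr0.
  split; first exact: y_dec.
  have y_ge0 c : 0 <= y c by apply: y_inf.1; exists c.
  by apply: le_trans (y_ge0 b); rewrite -oppr0 lev_N.
have [a /(_ a (directed_refl A_dir a))] := p_oc _ _ _ _ A_dir y_cvg _ e_gt0.
by rewrite subr0; exists a.
Qed.

(** With [M] and [N] directed sets whose suprema are [y] and [- y], an [a] in
[M] and a [b] in [N] satisfy [i a <= y <= - i b], so that the error of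
approximating [y] by [i a] is at most [- i (a + b)]; the elements [- (a + b)]
form a net decreasing to [0]. *)
Lemma range_dense (R : realType) (X : orderedVectorType R)
    (Z : vectorLatticeType R)
    (i : {linear X -> Z}) (p : X -> R) (X_pervasive : pervasive X)
    (p_oc : order_continuous p)
    (i_compl : dedekind_completion i) (y : Z) (e : R) :
  0 < e -> exists x z : X, dominates i z (y - i x) /\ p z < e.
Proof.
move=> e_gt0; have i_bipos := dedekind_bipositive i_compl.
have [M [[m0 Mm0] M_up [M_ub M_least]]] :=
  upward_directed_sup X_pervasive i_compl y.
have [N [[n0 Nn0] N_up [N_ub N_least]]] :=
  upward_directed_sup X_pervasive i_compl (- y).
pose A := {ab : X * X | M ab.1 /\ N ab.2}.
pose leA (s t : A) :=
  (sval s).1 <= (sval t).1 /\ (sval s).2 <= (sval t).2.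
pose gap (s : A) := - ((sval s).1 + (sval s).2).
have A_dir : directed leA.
  split=> [|s|s t u [st1 st2] [tu1 tu2]|[[a b] /= [Ma Nb]] [[c d] /= [Mc Nd]]].
  - by constructor; exists (m0, n0).
  - by split.
  - by split; [exact: le_trans tu1|exact: le_trans tu2].
  have [m [Mm am cm]] := M_up _ _ Ma Mc.
  have [n [Nn bn dn]] := N_up _ _ Nb Nd.
  by exists (exist _ (m, n) (conj Mm Nn)); split.
have gap_dec : net_decreases_to0 leA gap.
  split=> [s t [st1 st2]|]; first by rewrite lev_N lev_D.
  split=> [_ [[[a b] /= [Ma Nb]] _ <-]|z z_lb].
    rewrite -(bipositive_le i_bipos) linear0 linearN -oppr0 lev_N linearD.
    rewrite -(subrr y) lev_D//; first by apply: M_ub; exists a.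
    by apply: N_ub; exists b.
  rewrite -(bipositive_le i_bipos) linear0 -(lev_add2r (- y)) add0r addrC.
  rewrite -lev_subr; apply: N_least => _ [b Nb <-].
  rewrite lev_subr -linearD -lev_N opprK; apply: M_least => _ [a Ma <-].
  rewrite -linearN bipositive_le// -lev_N opprK addrC -lev_subr -opprD.
  by apply: z_lb; exists (exist _ (a, b) (conj Ma Nb)).
have [[[a b] /= [Ma Nb]]] := directed_decreases_to0_lt p_oc A_dir gap_dec e_gt0.
rewrite /gap/= => p_lt; exists a, (- (a + b)); split=> //; rewrite /dominates.
have a_le : i a <= y by apply: M_ub; exists a.
have b_le : i b <= - y by apply: N_ub; exists b.
rewrite linearN opprK; apply/andP; split.
  apply: (@le_trans _ _ 0); last by rewrite subv_ge0.
  by rewrite linearD -(subrr y) lev_D.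
by rewrite linearD opprD addrC lev_D// -lev_N opprK.
Qed.

(** * Seminorms *)

Lemma cvg0_ge0P (R : realType) (f : nat -> R) : (forall n, 0 <= f n) ->
  f n @[n --> \oo] --> (0 : R) <->
  forall e, 0 < e -> exists N, forall n, (N <= n)%N -> f n < e.
Proof.
move=> f_ge0; split=> [/cvgr0Pnorm_lt f0 e /f0[N _ HN]|f_lt].
  by exists N => n Nn; rewrite -[f n]ger0_norm//; apply: HN.
apply/cvgr0Pnorm_lt => e /f_lt[N HN]; exists N => // n Nn.
by rewrite ger0_norm//; apply: HN.
Qed.

Lemma natSinv_small (R : realType) (e : R) : 0 < e ->
  exists N, forall n, (N <= n)%N -> n.+1%:R^-1 < e.
Proof.
move=> e_gt0; have [N _ HN] := near_infty_natSinv_lt (PosNum e_gt0).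
by exists N => n Nn; apply: HN.
Qed.

Lemma seminorm0 (R : realType) (V : lmodType R) (p : V -> R) :
  seminorm p -> p 0 = 0.
Proof.
by move=> p_semi; rewrite -(scale0r 0) (seminormZ p_semi) normr0 mul0r.
Qed.

Lemma seminormN (R : realType) (V : lmodType R) (p : V -> R) (v : V) :
  seminorm p -> p (- v) = p v.
Proof.
by move=> p_semi; rewrite -scaleN1r (seminormZ p_semi) normrN1 mul1r.
Qed.

(** * Domination and the extended seminorm *)

Section Domination.
Context (R : realType) (X Z : orderedVectorType R) (i : {linear X -> Z}).

Lemma dominatesP z y : dominates i z y <-> y <= i z /\ - y <= i z.
Proof.
rewrite /dominates -[X in X && _](lev_N (R:=R)) opprK.
by split=> [/andP[-> ->]|[-> ->]].
Qed.

Lemma dominatesN z y : dominates i z y -> dominates i z (- y).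
Proof. by move=> /dominatesP[? ?]; apply/dominatesP; rewrite opprK. Qed.

Lemma dominatesD z z' y y' : dominates i z y -> dominates i z' y' ->
  dominates i (z + z') (y + y').
Proof.
move=> /dominatesP[? ?] /dominatesP[? ?]; apply/dominatesP.
rewrite linearD opprD.
by split; apply: lev_D.
Qed.

Lemma dominatesZ a z y : dominates i z y -> dominates i (`|a| *: z) (a *: y).
Proof.
move=> /dominatesP[zy zNy].
have pos b u v : 0 <= b -> u <= v :> Z -> b *: u <= b *: v.
  move=> b0 uv; rewrite -subv_ge0 -scalerBr; apply: scalev_ge0 => //.
  by rewrite subv_ge0.
apply/dominatesP; rewrite linearZ/= -scalerN; case: (ger0P a) => [a0|/ltW a0].
  by split; apply: pos.
have -> : a *: - y = - a *: y by rewrite scaleNr scalerN.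
have -> : a *: y = - a *: - y by rewrite scaleNr scalerN opprK.
by split; apply: pos; rewrite ?oppr_ge0.
Qed.

Context (p : X -> R) (p_reg : regular p) (i_bipos : bipositive i).

Lemma dominates_seminorm_le z x : dominates i z (i x) -> p x <= p z.
Proof.
rewrite /dominates -linearN !bipositive_le// => zx.
by apply: (p_reg x).1; exists z.
Qed.

End Domination.

Section ExtSeminorm.
Context (R : realType) (X : orderedVectorType R) (Z : vectorLatticeType R).
Context (i : {linear X -> Z}) (i_dense : order_dense (range i)).
Context (p : X -> R) (p_semi : seminorm p).

Lemma dominates_exists y : exists z, dominates i z y.
Proof.
have [z yz] := order_dense_above i_dense (vjoin y (- y)).
have [y_ub _] := vjoinP y (- y).
by exists z; apply/dominatesP; split; apply: le_trans yz; apply: y_ub;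
  [left|right].
Qed.

Lemma ext_seminorm_le z y : dominates i z y -> ext_seminorm i p y <= p z.
Proof.
move=> zy; apply: ge_inf; last by exists z.
by exists 0 => _ [x _ <-]; apply: seminorm_ge0.
Qed.

Lemma ext_seminorm_lt y e : ext_seminorm i p y < e ->
  exists2 z, dominates i z y & p z < e.
Proof.
have [z0 z0y] := dominates_exists y.
move=> /inf_lt[|_ [z zy <-] pz]; last by exists z.
by exists (p z0), z0.
Qed.

Lemma ext_seminorm_ge y c : (forall z, dominates i z y -> c <= p z) ->
  c <= ext_seminorm i p y.
Proof.
move=> c_le; apply: lb_le_inf => [|_ [z zy <-]]; last exact: c_le.
by have [z zy] := dominates_exists y; exists (p z), z.
Qed.

End ExtSeminorm.

(** * Extension by closing the graph *)

Section Extension.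
Context (R : realType) (X Z Y : orderedVectorType R).
Context (i : {linear X -> Z}) (i_bipos : bipositive i).
Context (p : X -> R) (p_semi : seminorm p) (p_reg : regular p).
Context (i_range_dense : forall (y : Z) e, 0 < e ->
  exists x z, dominates i z (y - i x) /\ p z < e).
Context (q : Y -> R) (q_semi : seminorm q).
Context (T : {linear X -> Y}) (C : R) (C_ge0 : 0 <= C)
        (T_le : forall x, q (T x) <= C * p x).

(** The closure of the graph of [T] for the extended seminorm on [Z], with that
seminorm unfolded into dominating elements. Linearity is immediate
for this relation, with no need to compare limits along chosen sequences. *)
Definition graph_closure (y : Z) (l : Y) : Prop :=
  forall e, 0 < e ->
    exists x z, [/\ dominates i z (y - i x), p z < e & q (l - T x) < e].

Lemma graph_closure_graph x : graph_closure (i x) (T x).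
Proof.
move=> e e_gt0; exists x, 0; rewrite !subrr !seminorm0//; split=> //.
by apply/dominatesP; rewrite linear0 oppr0.
Qed.

(** The tolerance [e / (|a| + 1)] turns the error [|a| * d + d] into [e]. *)
Lemma graph_closure_linear a y l y' l' :
  graph_closure y l -> graph_closure y' l' ->
  graph_closure (a *: y + y') (a *: l + l').
Proof.
move=> yl yl' e e_gt0.
have a1_gt0 : 0 < `|a| + 1 by rewrite ltr_wpDl.
have d_gt0 : 0 < e / (`|a| + 1) by rewrite divr_gt0.
have eE : e = `|a| * (e / (`|a| + 1)) + e / (`|a| + 1).
  by rewrite -{2}[e / _]mul1r -mulrDl mulrC divfK// gt_eqF.
have [x [z [xz pz qx]]] := yl _ d_gt0.
have [x' [z' [xz' pz' qx']]] := yl' _ d_gt0.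
exists (a *: x + x'), (`|a| *: z + z'); split.
- rewrite linearP opprD addrACA -scalerBr.
  by apply: dominatesD => //; apply: dominatesZ.
- apply: le_lt_trans (seminormD p_semi _ _) _; rewrite seminormZ// normr_id eE.
  by rewrite ler_ltD// ler_wpM2l// ltW.
- rewrite linearP opprD addrACA -scalerBr.
  apply: le_lt_trans (seminormD q_semi _ _) _; rewrite seminormZ// eE.
  by rewrite ler_ltD// ler_wpM2l// ltW.
Qed.

(** If [i x] is close to [y] then [x] is dominated by [w + z] with [p z] small,
so regularity bounds [p x], and hence the norm of [T x], up to a small error. *)
Lemma graph_closure_bound y l w : graph_closure y l -> dominates i w y ->
  q l <= C * p w.
Proof.
move=> yl wy; apply/ler_addgt0Pr => e e_gt0.
have C1_gt0 : 0 < C + 1 by rewrite ltr_wpDl.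
have d_gt0 : 0 < e / (C + 1) by rewrite divr_gt0.
have [x [z [xz pz qx]]] := yl _ d_gt0.
have px : p x <= p w + p z.
  apply: le_trans (seminormD p_semi _ _).
  apply: (dominates_seminorm_le p_reg i_bipos).
  rewrite -[i x](subrKC y) -opprB; apply: dominatesD => //; exact: dominatesN.
have -> : e = C * (e / (C + 1)) + e / (C + 1).
  by rewrite -{2}[e / _]mul1r -mulrDl mulrC divfK// gt_eqF.
rewrite -[l](subrK (T x)) addrC; apply: le_trans (seminormD q_semi _ _) _.
rewrite addrA -mulrDr lerD//; last exact: ltW.
apply: le_trans (T_le x) _.
by rewrite ler_wpM2l//; apply: le_trans px _; rewrite lerD2l ltW.
Qed.

Context (q_def : forall v, q v = 0 -> v = 0).

(** The difference of two values belongs to the closure above [0], which is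
dominated by [0]. *)
Lemma graph_closure_unique y l l' :
  graph_closure y l -> graph_closure y l' -> l = l'.
Proof.
move=> yl yl'; have := graph_closure_linear (-1) yl' yl.
rewrite !scaleN1r addNr => /(@graph_closure_bound _ _ 0).
rewrite (seminorm0 p_semi) mulr0 => ql.
apply/eqP; rewrite -subr_eq0 addrC; apply/eqP/q_def/le_anti.
rewrite seminorm_ge0// andbT; apply: ql; apply/dominatesP.
by rewrite linear0 oppr0.
Qed.

Context (q_complete : forall u : nat -> Y,
    (forall e : R, 0 < e -> exists N : nat, forall m n : nat,
       (N <= m)%N -> (N <= n)%N -> q (u m - u n) < e) ->
    exists l : Y, q (u n - l) @[n --> \oo] --> (0 : R)).

(** If [i (x n)] approximates [y] with errors tending to [0], regularity makes
[x n] a Cauchy sequence, so [T (x n)] converges. *)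
Lemma graph_closure_total y : exists l, graph_closure y l.
Proof.
have /choice[xz xzP] n : exists xz : X * X,
    dominates i xz.2 (y - i xz.1) /\ p xz.2 < n.+1%:R^-1.
  by have [|x [z xzP]] := @i_range_dense y n.+1%:R^-1; last by exists (x, z).
have small e : 0 < e -> exists N, forall n, (N <= n)%N -> p (xz n).2 < e.
  move=> /natSinv_small[N HN]; exists N => n /HN; exact: lt_trans (xzP n).2.
have [|l /cvg0_ge0P l_lim] := q_complete (u := fun n => T (xz n).1).
  move=> e e_gt0; have C1_gt0 : 0 < C + 1 by rewrite ltr_wpDl.
  have d_gt0 : 0 < e / 2 / (C + 1) by rewrite !divr_gt0.
  have [N HN] := small _ d_gt0.
  exists N => m n Nm Nn; rewrite -linearB; apply: le_lt_trans (T_le _) _.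
  have px : p ((xz m).1 - (xz n).1) <= p (xz n).2 + p (xz m).2.
    apply: le_trans (seminormD p_semi _ _).
    apply: (dominates_seminorm_le p_reg i_bipos).
    have -> : i ((xz m).1 - (xz n).1) = (y - i (xz n).1) - (y - i (xz m).1).
      by rewrite linearB opprB [RHS]addrC addrA subrK.
    by apply: dominatesD; [exact: (xzP n).1|apply/dominatesN; exact: (xzP m).1].
  apply: (@le_lt_trans _ _ ((C + 1) * (p (xz n).2 + p (xz m).2))).
    apply: (@ler_pM) => //; rewrite ?seminorm_ge0// lerDl//.
  rewrite -ltr_pdivlMl// mulrC [e]splitr mulrDl ltrD//; exact: HN.
exists l => e e_gt0; have [N HN] := small e e_gt0.
have [n|N' HN'] := l_lim _ _ e_gt0; first exact: seminorm_ge0.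
exists (xz (maxn N N')).1, (xz (maxn N N')).2; split.
- exact: (xzP _).1.
- by apply: HN; rewrite leq_maxl.
- by rewrite -(seminormN _ q_semi) opprB; apply: HN'; rewrite leq_maxr.
Qed.

Lemma graph_closure_linear_map :
  exists That : {linear Z -> Y}, forall y, graph_closure y (That y).
Proof.
have [f fP] := choice graph_closure_total.
have f_lin : linear f.
  move=> a u v; apply: graph_closure_unique (fP _) _.
  exact: graph_closure_linear.
pose h : {linear Z -> Y} := HB.pack f (GRing.isLinear.Build R Z Y *:%R f f_lin).
by exists h.
Qed.

(** The source of uniqueness: continuity forces every bounded extension to lie
in the closure of the graph of [T]. *)
Lemma bounded_extension_closure (D : R) (S : {linear Z -> Y}) :
  (forall y z, dominates i z y -> q (S y) <= D * p z) ->
  (forall x, S (i x) = T x) -> forall y, graph_closure y (S y).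
Proof.
move=> S_le ST y e e_gt0.
have D1_gt0 : 0 < `|D| + 1 by rewrite ltr_wpDl.
have D1_ge1 : 1 <= `|D| + 1 by rewrite lerDr.
have [x [z [xz pz]]] := i_range_dense y (divr_gt0 e_gt0 D1_gt0).
have pz' : (`|D| + 1) * p z < e by rewrite -ltr_pdivlMl// mulrC.
exists x, z; split=> //.
  by apply: le_lt_trans pz'; rewrite ler_peMl// seminorm_ge0.
rewrite -ST -linearB; apply: le_lt_trans pz'; apply: le_trans (S_le _ _ xz) _.
rewrite ler_wpM2r ?seminorm_ge0//; apply: le_trans (ler_norm _) _.
by rewrite lerDl.
Qed.

End Extension.

(** * Compactness *)

(** Approximating [u n] by [i (x n)] with error below [1 / (n + 1)] gives a
bounded sequence [x n] in [X]; a subsequence of [T (x n)] converges, and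
[That (u n)] differs from [T (x n)] by a null sequence. *)
Lemma compact_extension (R : realType) (X : orderedVectorType R)
    (Z : vectorLatticeType R) (Y : orderedVectorType R)
    (i : {linear X -> Z}) (p : X -> R) (q : Y -> R)
    (i_bipos : bipositive i) (i_dense : order_dense (range i))
    (p_semi : seminorm p) (p_reg : regular p) (q_semi : seminorm q)
    (i_range_dense : forall (y : Z) e, 0 < e ->
       exists x z, dominates i z (y - i x) /\ p z < e)
    (T : {linear X -> Y}) (That : {linear Z -> Y}) (C : R) :
  0 <= C -> (forall y z, dominates i z y -> q (That y) <= C * p z) ->
  (forall x, That (i x) = T x) ->
  compact_operator p q T -> compact_operator (ext_seminorm i p) q That.
Proof.
move=> C_ge0 That_le ThatT T_cpt u [M u_le].
have /choice[xz xzP] n : exists xz : X * X,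
    dominates i xz.2 (u n - i xz.1) /\ p xz.2 < n.+1%:R^-1.
  by have [|x [z xzP]] := i_range_dense (u n) n.+1%:R^-1; last by exists (x, z).
have [|phi [phi_incr [l l_lim]]] := T_cpt (fun n => (xz n).1).
  exists (M + 1 + 1) => n.
  have [|w wu pw] := @ext_seminorm_lt _ _ _ _ i_dense p (u n) (M + 1).
    by apply: le_lt_trans (u_le n) _; rewrite ltrDl.
  have [zu pz] := xzP n.
  have pz1 : p (xz n).2 <= 1.
    by apply: le_trans (ltW pz) _; rewrite invf_le1// ler1n.
  apply: (@le_trans _ _ (p w + p (xz n).2)); last by rewrite lerD// ltW.
  apply: le_trans (seminormD p_semi _ _).
  apply: (dominates_seminorm_le p_reg i_bipos).
  by rewrite -[i _](subrKC (u n)) -opprB; apply: dominatesD => //;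
    exact: dominatesN.
exists phi; split=> //; exists l.
have q_ge0 := seminorm_ge0 q_semi.
apply/cvg0_ge0P => // e e_gt0; have C1_gt0 : 0 < C + 1 by rewrite ltr_wpDl.
have e2_gt0 : 0 < e / 2 by rewrite divr_gt0.
have [N HN] := natSinv_small (divr_gt0 e2_gt0 C1_gt0).
have /cvg0_ge0P /(_ _ e2_gt0)[//|N' HN'] := l_lim.
exists (maxn N N') => n; rewrite geq_max => /andP[Nn N'n].
rewrite -[u _](subrK (i (xz (phi n)).1)) linearD ThatT -addrA.
apply: le_lt_trans (seminormD q_semi _ _) _; rewrite [e]splitr ltrD ?HN'//.
have [zu pz] := xzP (phi n).
apply: le_lt_trans (That_le _ _ zu) _.
apply: (@le_lt_trans _ _ ((C + 1) * p (xz (phi n)).2)).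
  by rewrite ler_wpM2r ?seminorm_ge0// lerDl.
rewrite -ltr_pdivlMl// mulrC; apply: lt_trans pz _; apply: HN.
have phi_ge k : (k <= phi k)%N.
  by elim: k => // k /leq_ltn_trans; apply; apply: phi_incr.
exact: leq_trans (phi_ge n).
Qed.

(** * The extension theorem *)

Unset Implicit Arguments.

Theorem theorem4p1 (R : realType)
    (X : orderedVectorType R) (pX : X -> R)
    (X_pre_riesz : pre_riesz X) (X_arch : archimedean X)
    (X_pervasive : pervasive X)
    (pX_seminorm : seminorm pX) (pX_oc : order_continuous pX)
    (pX_regular : regular pX)
    (Xd : vectorLatticeType R) (i : {linear X -> Xd})
    (Xd_completion : dedekind_completion i)
    (Y : vectorLatticeType R) (pY : Y -> R)
    (Y_banach : banach_lattice pY) (pY_oc : order_continuous pY)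
    (T : {linear X -> Y}) (T_bounded : bounded_operator pX pY T) :
  exists That : {linear Xd -> Y},
    [/\ bounded_operator (ext_seminorm i pX) pY That,
        (forall x : X, That (i x) = T x),
        (forall S : {linear Xd -> Y},
           bounded_operator (ext_seminorm i pX) pY S ->
           (forall x : X, S (i x) = T x) -> forall y : Xd, S y = That y)
      & compact_operator pX pY T ->
        compact_operator (ext_seminorm i pX) pY That].
Proof.
have [_ i_bipos i_dense] := Xd_completion.
have [pY_semi pY_def _ pY_complete] := Y_banach.
have [C0 T_le0] := T_bounded.
have T_le x : pY (T x) <= `|C0| * pX x.
  by apply: le_trans (T_le0 x) _; rewrite ler_wpM2r ?seminorm_ge0// ler_norm.
have C_ge0 : 0 <= `|C0| by [].
have i_range_dense := range_dense X_pervasive pX_oc Xd_completion.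
have [That That_cl] := graph_closure_linear_map i_bipos pX_seminorm pX_regular
  i_range_dense pY_semi C_ge0 T_le pY_def pY_complete.
have cl_unique := graph_closure_unique i_bipos pX_seminorm pX_regular
  pY_semi C_ge0 T_le pY_def.
have That_le y z : dominates i z y -> pY (That y) <= `|C0| * pX z.
  exact: (graph_closure_bound i_bipos pX_seminorm pX_regular pY_semi
    C_ge0 T_le).
have ThatT x : That (i x) = T x.
  by apply: cl_unique (That_cl _) _; apply: graph_closure_graph.
exists That; split=> //.
(* The constant is increased by one to make it positive, so that one can divide
   by it. *)
- exists (`|C0| + 1) => y; rewrite -ler_pdivrMl ?ltr_wpDl//.
  apply: ext_seminorm_ge => // z zy; rewrite ler_pdivrMl ?ltr_wpDl//.
  apply: le_trans (That_le _ _ zy) _.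
  by rewrite ler_wpM2r ?seminorm_ge0// lerDl.
- move=> S [D S_le] ST y; apply: cl_unique (That_cl y).
  apply: (bounded_extension_closure pX_seminorm i_range_dense
    (D := `|D|)) => //.
  move=> {}y z zy; apply: le_trans (S_le y) _.
  apply: (@le_trans _ _ (`|D| * ext_seminorm i pX y)); last first.
    by rewrite ler_wpM2l// ext_seminorm_le.
  rewrite ler_wpM2r ?ler_norm//; apply: ext_seminorm_ge => // w _.
  exact: seminorm_ge0.
- exact: (compact_extension i_bipos i_dense pX_seminorm pX_regular pY_semi
    i_range_dense C_ge0 That_le ThatT).
Qed.
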